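(* Let $d\ge 2$ be an integer, and let $b=b(n)\to\infty$ and $k=k(n)\to\infty$ be sequences of positive integers (as $n\to\infty$) with $b\ge k$ and $n/(bk)\to 0$. There exists no estimator (sequence of estimators) $V_n\in\mathcal{H}_{d,b}^k$ such that, for all $\varepsilon>0$, the following limit holds: $$\sup_{p\in\mathcal{D}_d}P\left(\|V_n-p\|>3\min_{q\in\mathcal{H}_{d,b}^k}\|p-q\|+\varepsilon\right)\to 0\quad\text{as } n\to\infty,$$ where $V_n$ is a function of $X_1,\ldots,X_n\overset{iid}{\sim}p$.
   Context: $\mathcal{D}_d$ is the set of all probability densities (with respect to Lebesgue measure) on $[0,1)^d$, and $\|\cdot\|$ is the $L^1$ norm. $[b]=\{1,\ldots,b\}$ and $\Delta_k$ is the set of probability vectors in $\mathbb{R}^k$ (nonnegative entries summing to one). For $i\in[b]$ let $h_{1,b,i}(x)=b\,\mathbf{1}\left(\frac{i-1}{b}\le x<\frac{i}{b}\right)$ on $[0,1)$, and let $\mathcal{H}_{1,b}=\operatorname{Conv}\{h_{1,b,i}: i\in[b]\}$ be the set of one-dimensional histograms with $b$ bins. The product symbol between functions denotes the outer (tensor) product: $\left(\prod_{j=1}^d f_j\right)(x_1,\ldots,x_d)=f_1(x_1)\cdots f_d(x_d)$. The set of multi-view histograms is $$\mathcal{H}_{d,b}^k=\left\{\sum_{i=1}^k w_i\prod_{j=1}^d f_{i,j}\;\middle|\; w\in\Delta_k,\ f_{i,j}\in\mathcal{H}_{1,b}\right\}.$$ An estimator $V_n\in\mathcal{H}_{d,b}^k$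 is a (measurable) map, not depending on $p$ or $\varepsilon$, from samples $(X_1,\ldots,X_n)\in([0,1)^d)^n$ to $\mathcal{H}_{d,b(n)}^{k(n)}$; $P$ is the probability over $X_1,\ldots,X_n$ iid with density $p$. *)

(* Defs.v *)
From HB Require Import structures.
From mathcomp Require Import all_boot all_order all_algebra.
From mathcomp Require Import all_classical all_reals all_analysis.
From mathcomp Require Import measurable_realfun.

Set Implicit Arguments.
Unset Strict Implicit.
Unset Printing Implicit Defensive.

Import Order.TTheory GRing.Theory Num.Theory.
Import numFieldNormedType.Exports.

Local Open Scope classical_set_scope.
Local Open Scope ring_scope.

Section tuple_measure.
Context {disp : measure_display} {T : measurableType disp} {R : realType}.
Local Open Scope ereal_scope.

Definition tcons n (x : T * n.-tuple T) : n.+1.-tuple T := [tuple of x.1 :: x.2].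

Lemma measurable_tcons n : measurable_fun [set: T * n.-tuple T] (@tcons n).
Proof. exact: measurable_cons. Qed.

Definition tuncons n (t : n.+1.-tuple T) : T * n.-tuple T :=
  (thead t, [tuple of behead t]).

Lemma tconsK n : cancel (@tcons n) (@tuncons n).
Proof.
move=> [x t]; rewrite /tuncons/tcons/= theadE; congr pair.
exact/val_inj.
Qed.

Lemma tunconsK n : cancel (@tuncons n) (@tcons n).
Proof. by move=> t; rewrite /tuncons/tcons/= -tuple_eta. Qed.

Lemma measurable_tuncons n : measurable_fun [set: n.+1.-tuple T] (@tuncons n).
Proof.
apply/measurable_fun_pairP; split; first exact: measurable_tnth.
exact: measurable_behead.
Qed.

(* The n-fold product of [mu]; meaningful when [mu] is a sigma-finite measure. *)
Fixpoint tuple_measure (mu : set T -> \bar R) n : set (n.-tuple T) -> \bar R :=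
  match n with
  | 0%N => \d_[tuple]
  | n'.+1 => pushforward (mu \x @tuple_measure mu n') (@tcons n')
  end.
Arguments tuple_measure : clear implicits.

Section sigma_finite.
Variable mu : {sigma_finite_measure set T -> \bar R}.

Let tuple_measure_bundle n :
  exists m : {sigma_finite_measure set (n.-tuple T) -> \bar R},
    tuple_measure mu n = m.
Proof.
elim: n => [|n [m mE]]; first by exists \d_[tuple].
pose q : {measure set (T * n.-tuple T)%type -> \bar R} := product_measure1 mu m.
pose p : set (n.+1.-tuple T) -> \bar R := pushforward q (@tcons n).
have mpre A : measurable A -> measurable (@tcons n @^-1` A).
  by move=> mA; rewrite -[X in measurable X]setTI; exact: measurable_tcons.
have p0 : p set0 = 0 by rewrite /p /pushforward preimage_set0 measure0.
have pge0 A : 0 <= p A by exact: (measure_ge0 q).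
have psa : semi_sigma_additive p.
  move=> F mF tF mUF; rewrite /p /pushforward preimage_bigcup.
  apply: measure_semi_sigma_additive.
  - by move=> k; exact: mpre.
  - apply/trivIsetP => /= i j _ _ ij; rewrite -preimage_setI.
    by move/trivIsetP : tF => /(_ _ _ _ _ ij) ->//; rewrite preimage_set0.
  - by rewrite -preimage_bigcup; exact: mpre.
have psf : sigma_finite setT p.
  have /sigma_finiteP[F [FT ndF Foo]] := sigma_finiteT mu.
  have /sigma_finiteP[G [GT ndG Goo]] := sigma_finiteT m.
  exists (fun k => @tuncons n @^-1` (F k `*` G k)).
    rewrite -preimage_bigcup; apply/seteqP; split=> // t _ /=.
    have [i _ Fi] : (\bigcup_i F i) (tuncons t).1 by rewrite -FT.
    have [j _ Gj] : (\bigcup_i G i) (tuncons t).2 by rewrite -GT.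
    exists (maxn i j) => //; split.
      by move: Fi; exact/subsetPset/ndF/leq_maxl.
    by move: Gj; exact/subsetPset/ndG/leq_maxr.
  move=> k; have [mF Fk] := Foo k; have [mG Gk] := Goo k; split.
    rewrite -[X in measurable X]setTI.
    by apply: measurable_tuncons => //; exact: measurableX.
  rewrite /p /pushforward (_ : _ @^-1` _ = F k `*` G k); last first.
    by rewrite -comp_preimage (_ : _ \o _ = id)//; apply/funext; exact: tconsK.
  by rewrite /= product_measure1E// lte_mul_pinfty// ge0_fin_numE.
pose H1 := isMeasure.Build _ _ _ p p0 pge0 psa.
pose pm : {measure set (n.+1.-tuple T) -> \bar R} := HB.pack p H1.
pose H2 := Measure_isSigmaFinite.Build _ _ _ pm psf.
pose ps : {sigma_finite_measure set (n.+1.-tuple T) -> \bar R} := 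
  HB.pack (Measure.sort pm) H2.
by exists ps; rewrite /= mE.
Qed.

Let tuple_measure0 n : tuple_measure mu n set0 = 0.
Proof. by have [m ->] := tuple_measure_bundle n; exact: measure0. Qed.

Let tuple_measure_ge0 n A : 0 <= tuple_measure mu n A.
Proof. by have [m ->] := tuple_measure_bundle n; exact: measure_ge0. Qed.

Let tuple_measure_sigma_additive n : semi_sigma_additive (tuple_measure mu n).
Proof.
by have [m ->] := tuple_measure_bundle n; exact: measure_semi_sigma_additive.
Qed.

HB.instance Definition _ n := isMeasure.Build _ _ _ (tuple_measure mu n)
  (tuple_measure0 n) (@tuple_measure_ge0 n) (@tuple_measure_sigma_additive n).

Let tuple_measure_sigma_finite n : sigma_finite setT (tuple_measure mu n).
Proof. by have [m ->] := tuple_measure_bundle n; exact: sigma_finiteT. Qed.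

HB.instance Definition _ n := Measure_isSigmaFinite.Build _ _ _
  (tuple_measure mu n) (tuple_measure_sigma_finite n).

Lemma tuple_measure_box n (A : 'I_n -> set T) :
  (forall i, measurable (A i)) ->
  tuple_measure mu n [set t | forall i, A i (tnth t i)] = \prod_(i < n) mu (A i).
Proof.
elim: n A => [|n IH] A mA.
  by rewrite big_ord0 /= diracE mem_set//= => -[].
rewrite big_ord_recl -IH//= /pushforward.
rewrite -product_measure1E//; last first.
  rewrite (_ : [set _ | _] = \bigcap_(i in [set: 'I_n])
      ((@tnth n T)^~ i @^-1` A (lift ord0 i))); last first.
    by apply/seteqP; split=> t /= h i; [move=> _|]; apply: h.
  apply: fin_bigcap_measurable => // i _.
  by rewrite -[X in measurable X]setTI; exact: measurable_tnth.
congr (_ _); apply/seteqP; split=> -[x t] /=.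
  move=> h; split; first exact: (h ord0).
  by move=> i; have := h (lift ord0 i); rewrite tnthS.
move=> [h0 h] i; have [j ->|->//] := unliftP ord0 i.
by rewrite tnthS; exact: h.
Qed.

End sigma_finite.
End tuple_measure.
Arguments tuple_measure {disp T R}.

Section multiview_histograms.
Context {R : realType}.
Local Notation point d := (d.-tuple (measurableTypeR R)).

Definition cube d : set (point d) := [set x | forall j, 0 <= tnth x j < 1].
Arguments cube : clear implicits.

Definition lebesgue_tuple d : set (point d) -> \bar R :=
  tuple_measure (@lebesgue_measure R) d.
Arguments lebesgue_tuple : clear implicits.
HB.instance Definition _ d := SigmaFiniteMeasure.on (lebesgue_tuple d).

Definition density d : set (point d -> R) := [set p : point d -> R |
  [/\ measurable_fun (cube d) p,
      forall x, cube d x -> 0 <= p x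
    & (\int[lebesgue_tuple d]_(x in cube d) (p x)%:E = 1)%E]].
Arguments density : clear implicits.

Definition density_law d (p : point d -> R) (A : set (point d)) : \bar R :=
  (\int[lebesgue_tuple d]_(x in A `&` cube d) (p x)%:E)%E.

Lemma measurable_cube d : measurable (cube d).
Proof.
rewrite (_ : cube d = \bigcap_(j in [set: 'I_d])
    ((@tnth d (measurableTypeR R))^~ j @^-1` `[0, 1[)); last first.
  by apply/seteqP; split=> x /= h j; [move=> _|]; have := h j;
    rewrite ?in_itv/=; [|apply].
apply: fin_bigcap_measurable => // j _.
rewrite -[X in measurable X]setTI.
by apply: measurable_tnth => //; exact: measurable_itv.
Qed.
Arguments measurable_cube : clear implicits.

(* For a density [p], [density_law p] is a probability, so by [tuple_measure_box]
   [tuple_measure (density_law p) n] is the law of n iid points of density [p]. *)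
Lemma density_law_probability d (p : point d -> R) : density d p ->
  exists P : probability (point d) R, density_law p = P.
Proof.
move=> [mp p0 p1].
pose g : point d -> \bar R := (EFin \o p) \_ (cube d).
have mg : measurable_fun [set: point d] g.
  apply: (measurable_restrictT (EFin \o p) (measurable_cube d)).1.
  exact/measurable_EFinP.
have g0 x : (0 <= g x)%E.
  rewrite /g patchE; case: ifPn => // /set_mem xD.
  by rewrite /= lee_fin; exact: p0.
pose nu A : \bar R := (\int[lebesgue_tuple d]_(x in A) g x)%E.
have dE : density_law p = nu.
  by apply/funext => A; rewrite /density_law integral_mkcondr.
have nu0 : nu set0 = 0%E by rewrite /nu integral_set0.
have nuge0 A : (0 <= nu A)%E by exact: integral_ge0.
have nusa : semi_sigma_additive nu by exact: semi_sigma_additive_nng_induced.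
have nuT : nu setT = 1%E by rewrite -dE /density_law setTI.
pose H1 := isMeasure.Build _ _ _ nu nu0 nuge0 nusa.
pose m : {measure set (point d) -> \bar R} := HB.pack nu H1.
pose H2 := Measure_isProbability.Build _ _ _ m nuT.
pose P : probability (point d) R := HB.pack (Measure.sort m) H2.
by exists P.
Qed.

Definition L1dist d (f g : point d -> R) : \bar R :=
  (\int[lebesgue_tuple d]_(x in cube d) `|f x - g x|%:E)%E.

Definition simplex k : set ('I_k -> R) :=
  [set w | (forall i, 0 <= w i) /\ \sum_(i < k) w i = 1].
Arguments simplex : clear implicits.

(* Bins are numbered from 0, and histograms on [0,1) (hence their tensor
   products on [0,1)^d) are extended by 0 to the whole space. *)
Definition hist_bin b (i : 'I_b) : R -> R :=
  fun x => b%:R * \1_(`[i%:R / b%:R, i.+1%:R / b%:R[ : set R) x.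

Definition histogram b : set (R -> R) :=
  [set f | exists2 u, simplex b u & f = fun x => \sum_(i < b) u i * hist_bin i x].
Arguments histogram : clear implicits.

Definition tensor d (f : 'I_d -> R -> R) : point d -> R :=
  fun x => \prod_(j < d) f j (tnth x j).

Definition multiview_histogram d b k : set (point d -> R) :=
  [set q | exists w : 'I_k -> R, exists f : 'I_k -> 'I_d -> R -> R,
    [/\ simplex k w,
        forall i j, histogram b (f i j)
      & q = fun x => \sum_(i < k) w i * tensor (f i) x]].
Arguments multiview_histogram : clear implicits.

Definition samples d n : set (n.-tuple (point d)) :=
  [set X | forall i, cube d (tnth X i)].
Arguments samples : clear implicits.

(* [U] meets [H] in a relatively open subset for the L1 distance *)
Definition L1_open_in d (H U : set (point d -> R)) := forall f, H f -> U f ->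
  exists2 e : R, 0 < e & forall g, H g -> (L1dist f g < e%:E)%E -> U g.

(* Measurability of an [H]-valued map refers to the Borel sigma-algebra of the
   L1 distance on [H]; the values outside [samples] are irrelevant. *)
Definition estimator d n (H : set (point d -> R)) :
    set (n.-tuple (point d) -> point d -> R) :=
  [set V | (forall X, samples d n X -> H (V X)) /\
    forall U, L1_open_in H U -> measurable (samples d n `&` V @^-1` U)].

(* This infimum is attained for [H := multiview_histogram d b k], which is
   compact as the continuous image of a product of simplices. *)
Definition min_dist d (H : set (point d -> R)) (p : point d -> R) : \bar R :=
  ereal_inf [set L1dist p q | q in H].

Definition bad_samples d n H (V : n.-tuple (point d) -> point d -> R)
    (p : point d -> R) (eps : R) : set (n.-tuple (point d)) :=
  samples d n `&` [set X | (3%:E * min_dist H p + eps%:E < L1dist (V X) p)%E].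

End multiview_histograms.
Arguments cube {R}.
Arguments measurable_cube {R}.
Arguments lebesgue_tuple {R}.
Arguments density {R}.
Arguments simplex {R}.
Arguments histogram {R}.
Arguments multiview_histogram {R}.
Arguments samples {R}.
Arguments estimator {R d}.

(* Main.v *)
Require Import Defs.
From mathcomp Require Import all_boot all_order all_algebra.
From mathcomp Require Import all_classical all_reals all_analysis.
From mathcomp Require Import measurable_realfun.
From mathcomp Require Import ring lra zify.

(* Put on [0,1)^d the grid of b^d cells. For h = b/2 and signs
   sigma : 'I_k * 'I_h -> bool, let p_sigma be the uniform mixture over (i, t) of
   the uniform densities on the cells (i, 2t + sigma(i, t), 0, ..., 0); it is a
   multi-view histogram with k components, so the benchmark min ||p_sigma - q||
   is 0. An estimate V yields a guess of every sign by comparing its values at the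
   two cells of each pair, and every wrong guess costs 1/(kh) in L1 distance.
   Samples missing a pair, which happens with probability (1 - 1/(kh))^n, have
   the same law under sigma and under sigma with that sign flipped. Averaging
   over sigma (Assouad's argument), a fraction at least (1 - n/(kh))/2 of the
   guesses is wrong in expectation; this tends to 1/2 as n/(bk) tends to 0. *)

Set Implicit Arguments.
Unset Strict Implicit.
Unset Printing Implicit Defensive.
Import Order.TTheory GRing.Theory Num.Theory.
Import numFieldNormedType.Exports.
Local Open Scope classical_set_scope.
Local Open Scope ring_scope.

(** * Product measures of measures that agree on a set *)

(** Used to compare the sample laws of two densities that differ only off [C]. The proof is by
    induction on [n]: the section of [A] at a point outside [C] is empty, so both outer integrals
    reduce to integrals over [C], where [mu] and [nu] can be exchanged. *)
Lemma tuple_measure_eq_on {disp} {T : measurableType disp} {R : realType}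
    (mu nu : {sigma_finite_measure set T -> \bar R}) (C : set T) n
    (A : set (n.-tuple T)) :
  (forall B, measurable B -> B `<=` C -> mu B = nu B) ->
  measurable A -> A `<=` [set t | forall i, C (tnth t i)] ->
  tuple_measure mu n A = tuple_measure nu n A.
Proof.
move=> eq_munu; elim: n A => [//|n IH] A mA AC /=.
rewrite /pushforward /product_measure1.
have mS : measurable (@tcons _ T n @^-1` A).
  by rewrite -[X in measurable X]setTI; exact: measurable_tcons.
have eqS x : tuple_measure mu n (xsection (@tcons _ T n @^-1` A) x) =
             tuple_measure nu n (xsection (@tcons _ T n @^-1` A) x).
  apply: IH; first exact: measurable_xsection.
  move=> t; rewrite /xsection /= inE /= => At i.
  by have := AC _ At (lift ord0 i); rewrite tnthS.
have offC x : ~ C x -> xsection (@tcons _ T n @^-1` A) x = set0.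
  move=> nCx; rewrite -subset0 => t; rewrite /xsection /= inE /= => At.
  by apply: nCx; have := AC _ At ord0.
transitivity (\int[mu]_(x in C)
    (tuple_measure mu n \o xsection (@tcons _ T n @^-1` A)) x)%E.
  rewrite [RHS]integral_mkcond; apply: eq_integral => x _.
  rewrite patchE; case: ifPn => // /negP; rewrite inE => /offC /= ->.
  exact: measure0.
transitivity (\int[nu]_(x in C)
    (tuple_measure nu n \o xsection (@tcons _ T n @^-1` A)) x)%E; last first.
  rewrite [LHS]integral_mkcond; apply: eq_integral => x _.
  rewrite patchE; case: ifPn => // /negP; rewrite inE => /offC /= ->.
  by rewrite measure0.
rewrite (eq_measure_integral nu); last exact: eq_munu.
by apply: eq_integral => x _ /=; rewrite eqS.
Qed.

(** * The grid of cells on the cube *)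

Section cells.
Context {R : realType} {d b : nat}.
Local Notation point := (d.-tuple (measurableTypeR R)).
Local Notation index := {ffun 'I_d -> 'I_b.+1}.

Definition bin_of (x : R) : 'I_b.+1 := inord (Num.trunc (x * b.+1%:R)).

Lemma bin_ofE (x : R) (i : 'I_b.+1) : 0 <= x < 1 ->
  (i%:R / b.+1%:R <= x < i.+1%:R / b.+1%:R) = (bin_of x == i).
Proof.
move=> /andP[x0 x1].
rewrite ler_pdivrMr ?ltr0n// ltr_pdivlMr ?ltr0n// -truncn_eq ?mulr_ge0//.
(* This bound keeps [inord] from falling back on its default value. *)
have xb : (Num.trunc (x * b.+1%:R) < b.+1)%N.
  by rewrite truncn_lt_nat ?mulr_ge0// gtr_pMl// ltr0n.
by rewrite -(inj_eq val_inj) /= inordK.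
Qed.

Lemma hist_binE (i : 'I_b.+1) (x : R) : 0 <= x < 1 ->
  hist_bin i x = b.+1%:R * (bin_of x == i)%:R.
Proof.
by move=> x01; rewrite /hist_bin indicE mem_setE in_itv/= bin_ofE.
Qed.

Definition cell_of (x : point) : index := [ffun j => bin_of (tnth x j)].

Definition cell (m : index) : set point := [set x | forall j,
  `[(m j)%:R / b.+1%:R, (m j).+1%:R / b.+1%:R[%classic (tnth x j : R)].

(** Cells are half-open, so each contains its lower corner, which serves as its representative
    point. *)
Definition corner (m : index) : point :=
  [tuple (m j)%:R / b.+1%:R : measurableTypeR R | j < d].

Lemma grid_itv (i : 'I_b.+1) (x : R) :
  i%:R / b.+1%:R <= x < i.+1%:R / b.+1%:R -> 0 <= x < 1.
Proof.
move=> /andP[ix xi]; apply/andP; split.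
  by apply: le_trans ix; rewrite divr_ge0.
apply: lt_le_trans xi _.
by rewrite ler_pdivrMr ?ltr0n// mul1r ler_nat ltn_ord.
Qed.

Lemma cellP (m : index) (x : point) : cell m x <-> cube d x /\ cell_of x = m.
Proof.
split=> [mx|[x01 <-] j].
  have x01 : cube d x by move=> j; apply: (@grid_itv (m j)); exact: mx.
  split=> //; apply/ffunP => j; apply/eqP.
  by rewrite ffunE -bin_ofE; [exact: mx|exact: x01].
by rewrite /= in_itv/= bin_ofE ?ffunE//; exact: x01.
Qed.

Lemma cell_corner (m : index) : cell m (corner m).
Proof.
move=> j; rewrite /= tnth_mktuple in_itv/= lexx/=.
by rewrite ltr_pM2r ?invr_gt0 ?ltr0n// ltr_nat.
Qed.

Lemma cube_corner (m : index) : cube d (corner m).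
Proof. by have /cellP[] := cell_corner m. Qed.

Lemma cell_of_corner (m : index) : cell_of (corner m) = m.
Proof. by have /cellP[] := cell_corner m. Qed.

Lemma measurable_cell (m : index) : measurable (cell m).
Proof.
rewrite (_ : cell m = \bigcap_(j in [set: 'I_d])
    ((@tnth d (measurableTypeR R))^~ j @^-1`
      `[(m j)%:R / b.+1%:R, (m j).+1%:R / b.+1%:R[)); last first.
  by apply/seteqP; split=> x h j; [move=> _|]; exact: h.
apply: fin_bigcap_measurable => // j _.
rewrite -[X in measurable X]setTI.
by apply: measurable_tnth => //; exact: measurable_itv.
Qed.

Lemma lebesgue_cell (m : index) :
  lebesgue_tuple d (cell m) = (b.+1%:R ^- d)%:E :> \bar R.
Proof.
pose A (j : 'I_d) : set (measurableTypeR R) :=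
  `[(m j)%:R / b.+1%:R, (m j).+1%:R / b.+1%:R[%classic.
rewrite /lebesgue_tuple (_ : cell m = [set t | forall j, A j (tnth t j)])//.
rewrite tuple_measure_box; last by move=> j; exact: measurable_itv.
rewrite (eq_bigr (fun=> (b.+1%:R^-1)%:E)) => [|j _]; last first.
  apply: etrans (lebesgue_measure_itv _) _ => /=.
  rewrite lte_fin ltr_pM2r ?invr_gt0 ?ltr0n// ltr_nat ltnSn.
  by rewrite -EFinB -mulrBl -natrB// subSnn mul1r.
by rewrite prodEFin prodr_const card_ord exprVn.
Qed.

Lemma cell_indicE (m : index) (x : point) : cube d x ->
  \1_(cell m) x = (cell_of x == m)%:R :> R.
Proof.
move=> x01; rewrite indicE; congr (_%:R); congr nat_of_bool.
apply/idP/eqP => [/set_mem/cellP[]//|xm].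
by apply/mem_set/cellP.
Qed.

Lemma cellwise_indic (F : index -> R) (x : point) : cube d x ->
  F (cell_of x) = \sum_m F m * \1_(cell m) x.
Proof.
move=> x01; rewrite (bigD1 (cell_of x))//= cell_indicE// eqxx mulr1.
rewrite big1 ?addr0// => m mx; rewrite cell_indicE// eq_sym.
by rewrite (negbTE mx) mulr0.
Qed.

Lemma measurable_cellwise (F : index -> R) :
  measurable_fun (@cube R d) (F \o cell_of).
Proof.
apply: (@eq_measurable_fun _ _ _ _ _ (fun x => \sum_m F m * \1_(cell m) x)).
  by move=> x /set_mem x01; rewrite /= cellwise_indic.
apply: measurable_sum => m; apply: measurable_funM => //.
by apply: measurable_indic; exact: measurable_cell.
Qed.

Lemma integral_cellwise (F : index -> R) : (forall m, 0 <= F m) ->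
  (\int[lebesgue_tuple d]_(x in cube d) (F (cell_of x))%:E =
   (b.+1%:R ^- d * \sum_m F m)%:E)%E.
Proof.
move=> F0.
rewrite (eq_integral (fun x => \sum_m (F m)%:E * (\1_(cell m) x)%:E)%E); last first.
  by move=> x /set_mem x01; rewrite cellwise_indic// -sumEFin.
have mI m : measurable_fun (cube d) (fun x : point => (\1_(cell m) x : R)%:E).
  by apply/measurable_EFinP; apply: measurable_indic; exact: measurable_cell.
rewrite ge0_integral_sum//; last 3 first.
- exact: measurable_cube.
- by move=> m; apply: measurable_funeM; exact: mI.
- by move=> m x _; rewrite mule_ge0// lee_fin.
rewrite mulr_sumr -sumEFin; apply: eq_bigr => m _.
rewrite (ge0_integralZl_EFin _ (measurable_cube d) _ (mI m))//.
rewrite integral_indic; [|exact: measurable_cube|exact: measurable_cell].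
rewrite setIidl; last by move=> x /cellP[].
by rewrite EFinM muleC; congr (_ * _)%E; exact: lebesgue_cell.
Qed.

End cells.

(** * Functions constant on cells, and their L1 geometry *)

Section cellwise_functions.
Context {R : realType} {d b : nat}.
Local Notation point := (d.-tuple (measurableTypeR R)).
Local Notation index := {ffun 'I_d -> 'I_b.+1}.
Implicit Types (f g p : point -> R) (m : index).

(** Constancy on cells is encoded by comparison with the corner, so that such a function is given on
    the cube by finitely many corner values; nothing is required off the cube. *)
Definition cellwise f := forall x, cube d x -> f x = f (corner (cell_of (b := b) x)).

Lemma multiview_histogram_cellwise k f :
  multiview_histogram d b.+1 k f -> cellwise f.
Proof.
move=> [w [F [_ hF ->]]] x x01; apply: eq_bigr => i _; congr (_ * _).
apply: eq_bigr => j _; have [u _ ->] := hF i j.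
apply: eq_bigr => l _; congr (_ * _).
rewrite !hist_binE; [|exact: cube_corner|exact: x01].
have := cell_of_corner (R := R) (cell_of (b := b) x).
by move=> /(congr1 (fun m : index => m j)); rewrite !ffunE => ->.
Qed.

Definition cell_dist f g : R :=
  b.+1%:R ^- d * \sum_(m : index) `|f (corner m) - g (corner m)|.

Lemma L1dist_cellwise f g : cellwise f -> cellwise g ->
  L1dist f g = (cell_dist f g)%:E.
Proof.
move=> cf cg; rewrite /L1dist /cell_dist.
rewrite -(integral_cellwise (F := fun m : index => `|f (corner m) - g (corner m)|))//.
by apply: eq_integral => x /set_mem x01; rewrite -cf// -cg.
Qed.

Lemma cell_dist_le f g h : cell_dist f h <= cell_dist f g + cell_dist g h.
Proof.
rewrite /cell_dist -mulrDr ler_pM2l ?invr_gt0 ?exprn_gt0 ?ltr0n//.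
by rewrite -big_split; apply: ler_sum => m _; exact: ler_distD.
Qed.

Lemma cell_dist_ge_cell f g m :
  `|f (corner m) - g (corner m)| <= b.+1%:R ^+ d * cell_dist f g.
Proof.
rewrite /cell_dist mulrA divff ?expf_neq0 ?pnatr_eq0// mul1r.
by rewrite (bigD1 m)//= lerDl sumr_ge0.
Qed.

(** Makes the guess of a sign a measurable event. A corner value moves by at most [B] times the L1
    distance, so within a radius of the gap over 2[B] the two values cannot change order. *)
Lemma L1_open_lt (H : set (point -> R)) m m' : H `<=` cellwise ->
  L1_open_in H [set f | f (corner m) < f (corner m')].
Proof.
move=> Hc f Hf /= fmm; pose B : R := b.+1%:R ^+ d.
have B0 : 0 < B by rewrite exprn_gt0.
exists ((f (corner m') - f (corner m)) / (2 * B)).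
  by rewrite divr_gt0 ?subr_gt0// mulr_gt0.
move=> g Hg; rewrite L1dist_cellwise; [|exact: Hc|exact: Hc].
rewrite lte_fin ltr_pdivlMr ?mulr_gt0// => fg.
have /ler_normlP[] := cell_dist_ge_cell f g m.
have /ler_normlP[] := cell_dist_ge_cell f g m'.
rewrite -/B; move: fg; rewrite (_ : _ * (2 * B) = 2 * (B * cell_dist f g)); last by ring.
move: (B * _) => D; lra.
Qed.

(** Makes the failure event measurable, by the triangle inequality. The threshold is an extended
    real because [min_dist] is one. *)
Lemma L1_open_far (H : set (point -> R)) p (t : \bar R) :
  H `<=` cellwise -> cellwise p ->
  L1_open_in H [set f | (t < L1dist f p)%E].
Proof.
move=> Hc cp f Hf /=; rewrite L1dist_cellwise//; last exact: Hc.
case: t => [t|//|_]; last first.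
  by exists 1 => // g Hg _; rewrite L1dist_cellwise ?ltNyr//; exact: Hc.
rewrite lte_fin => tf; exists (cell_dist f p - t); first by rewrite subr_gt0.
move=> g Hg; rewrite L1dist_cellwise; [|exact: Hc|exact: Hc].
rewrite L1dist_cellwise//; last exact: Hc.
rewrite !lte_fin; have := cell_dist_le f g p; lra.
Qed.

Lemma density_cellwise p : cellwise p -> (forall m, 0 <= p (corner m)) ->
  b.+1%:R ^- d * \sum_(m : index) p (corner m) = 1 -> density d p.
Proof.
move=> cp p0 p1; split.
- apply: (@eq_measurable_fun _ _ _ _ _ ((fun m => p (corner m)) \o cell_of)).
    by move=> x /set_mem x01; rewrite /= -cp.
  exact: measurable_cellwise.
- by move=> x x01; rewrite cp.
- rewrite -p1 -(integral_cellwise (F := fun m : index => p (corner m)))//.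
  by apply: eq_integral => x /set_mem x01; rewrite -cp.
Qed.

Definition cells (S : pred index) : set point :=
  [set x | cube d x /\ S (cell_of x)].

Lemma measurable_cells (S : pred index) : measurable (cells S).
Proof.
(* The indicator of [S] is taken with real values so that [measurable_cellwise] applies to it. *)
rewrite (_ : cells S = cube d `&`
    ((fun m => (S m)%:R : R) \o cell_of) @^-1` [set 1]); last first.
  apply/seteqP; split=> x /= [x01 Sx]; first by rewrite Sx.
  split=> //; apply: contraPT Sx => /negbTE -> /eqP.
  by rewrite eq_sym oner_eq0.
exact: measurable_cellwise (measurable_cube d) _ (measurable_set1 _).
Qed.

Lemma density_law_cells p (S : pred index) :
  cellwise p -> (forall m, 0 <= p (corner m)) ->
  density_law p (cells S) =
  (b.+1%:R ^- d * \sum_(m : index | S m) p (corner m))%:E.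
Proof.
move=> cp p0; rewrite /density_law setIC integral_mkcondr big_mkcond.
rewrite -(integral_cellwise (F := fun m : index =>
    if S m then p (corner m) else 0)); last first.
  by move=> m; case: ifP.
apply: eq_integral => x /set_mem x01; rewrite patchE.
have -> : (x \in cells S) = S (cell_of x).
  by apply/idP/idP => [/set_mem[]//|Sx]; apply/mem_set.
by case: ifP => // _; rewrite -cp.
Qed.

End cellwise_functions.

(** * Finite sums along injections and products of indicators *)

Lemma ler_sum_inj (R : numDomainType) (I J : finType) (g : I -> J) (F : J -> R) :
  injective g -> (forall j, 0 <= F j) -> \sum_i F (g i) <= \sum_j F j.
Proof.
move=> g_inj F0.
have -> : \sum_i F (g i) = \sum_(j in (g @: predT)%SET) F j.
  by rewrite big_imset//= => i j _ _; exact: g_inj.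
by rewrite [leRHS](bigID (mem (g @: predT)%SET))/= lerDl sumr_ge0.
Qed.

Lemma prodr_pred (R : comNzRingType) (I : finType) (P : pred I) :
  \prod_i ((P i)%:R : R) = [forall i, P i]%:R.
Proof.
case: (boolP [forall i, P i]) => [/forallP Pi|].
  by rewrite big1// => i _; rewrite Pi.
rewrite negb_forall => /existsP[i /negbTE Pi].
by rewrite (bigD1 i)//= Pi mul0r.
Qed.

(** * The hard densities indexed by sign vectors *)

Section hard_densities.
Context {R : realType} {d b k h : nat}.
Hypotheses (k_gt0 : (0 < k)%N) (h_gt0 : (0 < h)%N)
  (k_le : (k <= b.+1)%N) (h_le : (h.*2 <= b.+1)%N).
Local Notation point := (d.+2.-tuple (measurableTypeR R)).
Local Notation index := {ffun 'I_d.+2 -> 'I_b.+1}.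
Local Notation pair := ('I_k * 'I_h)%type.
Local Notation signs := {ffun pair -> bool}.
Implicit Types (c : pair) (s : bool) (sigma : signs) (m : index).

(** Axis 0 separates the mixture components, and axis 1 carries the pair together with its sign;
    this is where dimension at least 2 enters. *)
Definition hard_cell c s : index := [ffun j : 'I_d.+2 =>
  if j == 0 :> nat then inord c.1 else
  if j == 1 :> nat then inord (c.2.*2 + s) else ord0].

(** [k_le] and [h_le] keep the arguments of [inord] in range. Axis 0 then returns the component, the
    parity of axis 1 the sign, and its half the pair. *)
Lemma hard_cell_inj : injective (fun cs : pair * bool => hard_cell cs.1 cs.2).
Proof.
move=> [[i t] s] [[i' t'] s'] /= /ffunP eqm.
have lt_bin (u : 'I_h) r : (u.*2 + nat_of_bool r < b.+1)%N.
  by have := ltn_ord u; move: (nat_of_ord u) h_le => u'; case: r; lia.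
have := congr1 val (eqm ord0); rewrite !ffunE/= !inordK; last 2 first.
  1,2: by apply: leq_trans k_le.
move=> /val_inj ->.
have := congr1 val (eqm (lift ord0 ord0)); rewrite !ffunE/= !inordK//.
move=> e; have ss : s = s'.
  by have := congr1 odd e; rewrite !oddD !odd_double !oddb.
by move: e; rewrite ss => /addIn/double_inj/val_inj ->.
Qed.

Lemma hard_cell_eq c s c' s' :
  (hard_cell c s == hard_cell c' s') = (c == c') && (s == s').
Proof. by rewrite (inj_eq hard_cell_inj (c, s) (c', s')). Qed.

(** The marginal of component [i] on axis [j]: uniform over [h] bins on axis 1, a point mass on
    every other axis. Averaging over [t] on all axes covers both cases by one formula. *)
Definition hard_weight sigma (i : 'I_k) (j : 'I_d.+2) (l : 'I_b.+1) : R :=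
  h%:R^-1 * \sum_(t < h) (hard_cell (i, t) (sigma (i, t)) j == l)%:R.

Definition hard_density sigma : point -> R := fun x =>
  \sum_(i < k) k%:R^-1 *
    tensor (fun j y => \sum_l hard_weight sigma i j l * hist_bin l y) x.

Lemma hard_density_multiview sigma :
  multiview_histogram d.+2 b.+1 k (hard_density sigma).
Proof.
exists (fun=> k%:R^-1), (fun i j y => \sum_l hard_weight sigma i j l * hist_bin l y).
split=> //; first split=> //.
  by rewrite sumr_const card_ord -[LHS]mulr_natl divff// pnatr_eq0 -lt0n.
move=> i j; exists (hard_weight sigma i j) => //; split=> [l|].
  by rewrite mulr_ge0// sumr_ge0.
rewrite -mulr_sumr exchange_big/= (eq_bigr (fun=> 1)) => [|t _].
  by rewrite sumr_const card_ord mulVf// pnatr_eq0 -lt0n.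
by rewrite (bigD1 (hard_cell (i, t) (sigma (i, t)) j))//= eqxx big1 ?addr0//
  => l /negbTE; rewrite eq_sym => ->.
Qed.

Lemma hard_density_cellwise sigma : cellwise (b := b) (hard_density sigma).
Proof. exact: multiview_histogram_cellwise (hard_density_multiview sigma). Qed.

(* Only the weights of axis 1 depend on [t], so the product over the axes
   distributes over the average over [t]. *)
Lemma prod_hard_weight sigma i m :
  \prod_j hard_weight sigma i j (m j) =
  h%:R^-1 * \sum_(t < h) (hard_cell (i, t) (sigma (i, t)) == m)%:R.
Proof.
rewrite (bigD1 (lift ord0 ord0 : 'I_d.+2))//= /hard_weight -mulrA mulr_suml.
congr (_ * _); apply: eq_bigr => t _.
have -> : (hard_cell (i, t) (sigma (i, t)) == m) =
    [forall j, hard_cell (i, t) (sigma (i, t)) j == m j].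
  by apply/eqP/forallP => [-> //|e]; apply/ffunP => j; exact/eqP.
rewrite -prodr_pred [RHS](bigD1 (lift ord0 ord0 : 'I_d.+2))//=; congr (_ * _).
apply: eq_bigr => j j1.
have j1' : (j == 1 :> nat) = false by apply: contraNF j1 => /eqP j1; exact/eqP/val_inj.
rewrite (eq_bigr (fun=> (hard_cell (i, t) (sigma (i, t)) j == m j)%:R)) => [|t' _].
  by rewrite sumr_const card_ord -[X in _ * X]mulr_natl mulKf// pnatr_eq0 -lt0n.
by rewrite !ffunE j1'.
Qed.

(** Each axis contributes a bin height [b.+1]. Since a cell has volume [b.+1] to the power -(d+2),
    every selected cell receives mass 1/(kh). *)
Lemma hard_density_corner sigma m :
  hard_density sigma (corner m) =
  b.+1%:R ^+ d.+2 / (k * h)%:R * \sum_c (hard_cell c (sigma c) == m)%:R.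
Proof.
rewrite (_ : \sum_c _ = \sum_(i < k) \sum_(t < h)
    (hard_cell (i, t) (sigma (i, t)) == m)%:R); last first.
  by rewrite pair_bigA; apply: eq_bigr => -[].
rewrite mulr_sumr; apply: eq_bigr => i _.
rewrite /tensor (eq_bigr (fun j => b.+1%:R * hard_weight sigma i j (m j))) => [|j _].
  rewrite big_split prodr_const card_ord/= prod_hard_weight natrM invfM; ring.
have bm : bin_of (tnth (corner (R := R) m) j) = m j.
  by have /(congr1 (fun m : index => m j)) := cell_of_corner (R := R) m; rewrite ffunE.
rewrite (bigD1 (m j))//= hist_binE ?bm; last exact: cube_corner.
rewrite eqxx mulr1 mulrC big1 ?addr0// => l /negbTE lm.
by rewrite hist_binE ?bm 1?eq_sym ?lm ?mulr0//; exact: cube_corner.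
Qed.

Lemma hard_density_hard_cell sigma c s :
  hard_density sigma (corner (hard_cell c s)) =
  b.+1%:R ^+ d.+2 / (k * h)%:R * (sigma c == s)%:R.
Proof.
rewrite hard_density_corner (bigD1 c)//= hard_cell_eq eqxx big1 ?addr0// => c' /negbTE cc.
by rewrite hard_cell_eq cc.
Qed.

Lemma hard_density_ge0 sigma m : 0 <= hard_density sigma (corner m).
Proof. by rewrite hard_density_corner mulr_ge0 ?divr_ge0 ?exprn_ge0 ?sumr_ge0. Qed.

Let B_neq0 : b.+1%:R ^+ d.+2 != 0 :> R.
Proof. by rewrite expf_neq0// pnatr_eq0. Qed.

Lemma sum_hard_density sigma :
  b.+1%:R ^- d.+2 * \sum_(m : index) hard_density sigma (corner m) = 1.
Proof.
under eq_bigr do rewrite hard_density_corner.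
rewrite -mulr_sumr exchange_big/= (eq_bigr (fun=> 1)) => [|c _].
  rewrite sumr_const card_prod !card_ord mulrA mulKf// mulVf//.
  by rewrite pnatr_eq0 -lt0n muln_gt0 k_gt0.
rewrite (bigD1 (hard_cell c (sigma c)))//= eqxx big1 ?addr0// => m /negbTE.
by rewrite eq_sym => ->.
Qed.

Lemma density_hard_density sigma : density d.+2 (hard_density sigma).
Proof.
apply: (@density_cellwise _ _ b); first exact: hard_density_cellwise.
  exact: hard_density_ge0.
exact: sum_hard_density.
Qed.

Definition off_pair c : pred index :=
  [pred m | (m != hard_cell c false) && (m != hard_cell c true)].

(** Whatever the sign of [c], exactly one of its two cells is selected and carries mass 1/(kh). The
    probability of avoiding the pair is therefore the same for all [sigma]. *)
Lemma law_off_pair sigma c :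
  density_law (hard_density sigma) (cells (off_pair c)) = (1 - (k * h)%:R^-1)%:E.
Proof.
rewrite density_law_cells; [|exact: hard_density_cellwise|exact: hard_density_ge0].
congr (_%:E); have := sum_hard_density sigma.
rewrite (bigD1 (hard_cell c false))//= (bigD1 (hard_cell c true))/=; last first.
  by rewrite hard_cell_eq andbF.
rewrite !hard_density_hard_cell !mulrDr !(mulrA _ (_ / _) _) mulKf//.
case: (sigma c); rewrite /= ?mulr1 ?mulr0 ?add0r => e;
  by apply/eqP; rewrite eq_sym subr_eq addrC e.
Qed.

Definition flip c sigma : signs := [ffun c' => sigma c' (+) (c' == c)].

Lemma flipK c : involutive (flip c).
Proof. by move=> sigma; apply/ffunP => c'; rewrite !ffunE -addbA addbb addbF. Qed.

(** Flipping the sign of [c] only moves mass between the two cells of [c]. *)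
Lemma hard_density_flip sigma c x : cells (off_pair c) x ->
  hard_density (flip c sigma) x = hard_density sigma x.
Proof.
move=> [x01 /= /andP[x0 x1]].
rewrite (hard_density_cellwise sigma)// (hard_density_cellwise (flip c sigma))//.
rewrite !hard_density_corner; congr (_ * _); apply: eq_bigr => c' _.
rewrite ffunE; have [->|] := eqVneq c' c; last by rewrite addbF.
have off s : (hard_cell c s == cell_of x) = false.
  by rewrite eq_sym; apply/negbTE; case: s.
by rewrite !off.
Qed.

(** A tie is read as [false]; this is harmless, since a weak inequality in the wrong direction is
    enough for the cost of an error. *)
Definition guess (f : point -> R) c : bool :=
  f (corner (hard_cell c false)) < f (corner (hard_cell c true)).

(** Let [V] be the height of a selected cell. If the estimate is at least as large on the empty cell
    as on the selected one, its errors on the two cells add up to at least [V], which after scaling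
    by the cell volume is 1/(kh). By [hard_cell_inj] the pairs are disjoint, so these costs add
    up. *)
Lemma cell_dist_hard_density f sigma :
  (k * h)%:R^-1 * \sum_c (guess f c != sigma c)%:R
    <= cell_dist (b := b) f (hard_density sigma).
Proof.
pose F m := `|f (corner m) - hard_density sigma (corner m)|.
apply: (@le_trans _ _
  (b.+1%:R ^- d.+2 * \sum_(cs : pair * bool) F (hard_cell cs.1 cs.2))).
  rewrite [X in _ <= _ * X](_ : _ = \sum_c \sum_s F (hard_cell c s)); last first.
    by rewrite (pair_bigA _ (fun c s => F (hard_cell c s))).
  rewrite !mulr_sumr; apply: ler_sum => c _.
  rewrite big_bool/= /F !hard_density_hard_cell ler_pdivlMl ?exprn_gt0 ?ltr0n// mulrA.
  have V0 : 0 <= b.+1%:R ^+ d.+2 / (k * h)%:R :> R by [].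
  move: V0; rewrite /guess; move: (_ / _) (f _) (f _) => V y z V0.
  have := ler_norm (y - V); have := ler_norm (V - y); rewrite (distrC V).
  have := ler_norm (z - V); have := ler_norm (V - z); rewrite (distrC V).
  have := ler_norm y; have := ler_norm z; have := ler_norm (- y); have := ler_norm (- z).
  rewrite !normrN; case: ltP; case: (sigma c) => /=; rewrite ?mulr1 ?mulr0 ?subr0; lra.
rewrite /cell_dist ler_pM2l ?invr_gt0 ?exprn_gt0 ?ltr0n//.
by apply: (ler_sum_inj (F := F) hard_cell_inj) => m; exact: normr_ge0.
Qed.

End hard_densities.

(** * From pointwise bounds to expectations, and Bernoulli's inequality *)

(** Turns a bound on the number of wrong guesses, valid sample by sample, into a bound on its
    expectation. *)
Lemma sum_measure_le_indic {disp} {T : measurableType disp} {R : realType}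
    (mu : {measure set T -> \bar R}) (I : finType) (E : I -> set T) (B : set T)
    (a K : R) :
  mu setT = 1%E -> (forall i, measurable (E i)) -> measurable B ->
  0 <= a -> 0 <= K -> (forall x, \sum_i \1_(E i) x <= a + K * \1_B x) ->
  (\sum_i mu (E i) <= a%:E + K%:E * mu B)%E.
Proof.
move=> mu1 mE mB a0 K0 leEB.
have mI (A : set T) : measurable A -> measurable_fun setT (fun x => (\1_A x : R)%:E).
  by move=> mA; apply/measurable_EFinP; exact: measurable_indic.
have intI (A : set T) : measurable A -> (\int[mu]_x (\1_A x : R)%:E = mu A)%E.
  by move=> mA; rewrite integral_indic// setIT.
rewrite -(intI B mB) -ge0_integralZl_EFin//; last exact: mI.
rewrite -[a%:E]mule1 -mu1 -integral_cst// -ge0_integralD//; last 2 first.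
- by move=> x _; rewrite mule_ge0// lee_fin.
- by apply: measurable_funeM; exact: mI.
rewrite (eq_bigr (fun i => \int[mu]_x (\1_(E i) x : R)%:E)%E); last first.
  by move=> i _; rewrite intI.
rewrite -(@ge0_integral_sum _ _ _ mu setT measurableT _
  (fun i x => (\1_(E i) x)%:E))//; last first.
- by move=> i; exact: mI.
apply: ge0_le_integral => //.
- by move=> x _; apply: sume_ge0 => i _; rewrite lee_fin.
- by apply: emeasurable_sum => i; exact: mI.
- by apply: emeasurable_funD => //; apply: measurable_funeM; exact: mI.
- by move=> x _; rewrite sumEFin lee_fin.
Qed.

Lemma bernoulli_ineq {R : realFieldType} (x : R) n : 0 <= x <= 1 ->
  1 - n%:R * x <= (1 - x) ^+ n.
Proof.
move=> /andP[x0 x1]; elim: n => [|n IH]; first by rewrite mul0r subr0.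
rewrite exprS; apply: (@le_trans _ _ ((1 - x) * (1 - n%:R * x))).
  have : 0 <= n%:R * x ^+ 2 by rewrite mulr_ge0// exprn_ge0.
  by rewrite -natr1; lra.
by rewrite ler_wpM2l// subr_ge0.
Qed.

(** * Assouad's argument for a fixed sample size *)

Section minimax_lower_bound.
Context {R : realType} {d b k h n : nat}.
Hypotheses (k_gt0 : (0 < k)%N) (h_gt0 : (0 < h)%N)
  (k_le : (k <= b.+1)%N) (h_le : (h.*2 <= b.+1)%N).
Local Notation point := (d.+2.-tuple (measurableTypeR R)).
Local Notation index := {ffun 'I_d.+2 -> 'I_b.+1}.
Local Notation pair := ('I_k * 'I_h)%type.
Local Notation signs := {ffun pair -> bool}.
Local Notation H := (@multiview_histogram R d.+2 b.+1 k).
Variables (V : n.-tuple point -> point -> R).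
Hypothesis V_estimator : estimator n H V.
Implicit Types (c : pair) (sigma : signs).
Local Notation guess := (@guess R d b k h).
Local Notation hard sigma := (@hard_density R d b k h sigma).

Let H_cellwise : H `<=` cellwise (b := b).
Proof. by move=> f; exact: multiview_histogram_cellwise. Qed.

(** A bundled probability is chosen so that its tuple measure carries a measure structure, which the
    bare set function [density_law] does not. *)
Let law_bundle sigma : {P : probability point R | density_law (hard sigma) = P}.
Proof. by apply/cid/density_law_probability/density_hard_density. Qed.

Let law sigma : probability point R := sval (law_bundle sigma).

Let lawE sigma : density_law (hard sigma) = law sigma.
Proof. exact: svalP (law_bundle sigma). Qed.

Let mu sigma : {measure set (n.-tuple point) -> \bar R} :=
  tuple_measure (law sigma) n.

Let mu_setT sigma : mu sigma setT = 1%E.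
Proof.
pose A (_ : 'I_n) : set point := setT.
rewrite (_ : setT = [set t : n.-tuple point | forall i, A i (tnth t i)]); last first.
  by apply/seteqP; split.
apply: (etrans (tuple_measure_box (law sigma) (A := A) _)).
  by move=> i; exact: measurableT.
by rewrite big1// => i _; exact: probability_setT.
Qed.

Let guessed c : set (n.-tuple point) :=
  samples d.+2 n `&` V @^-1` [set f | guess f c].

Let wrong sigma c : set (n.-tuple point) :=
  samples d.+2 n `&` [set X | guess (V X) c != sigma c].

Let measurable_samples : measurable (@samples R d.+2 n).
Proof.
rewrite -[X in measurable X]setIT.
(* The whole space is relatively open, and its preimage under [V] is everything. *)
by apply: (V_estimator.2 setT) => f _ _; exists 1.
Qed.

Let measurable_wrong sigma c : measurable (wrong sigma c).
Proof.
have mG : measurable (guessed c) by apply: V_estimator.2; exact: L1_open_lt.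
have [sc|sc] := boolP (sigma c).
  rewrite (_ : wrong sigma c = samples d.+2 n `\` guessed c); first exact: measurableD.
  apply/seteqP; split=> X /= [SX]; rewrite /wrong/= sc.
    by move=> /negP GX; split=> // -[_ /= g]; apply: GX; rewrite g.
  by move=> GX; split=> //; apply/negP => /eqP g; apply: GX; split.
rewrite (_ : wrong sigma c = guessed c)//; apply/seteqP; split=> X /= [SX];
  by rewrite /wrong/guessed/= (negbTE sc); case: (guess _ _).
Qed.

(** At radius 1/4 a successful estimate has at most a quarter of its guesses wrong, well below the
    half that the averaging over signs forces in the limit. *)
Let bad sigma := bad_samples H V (hard sigma) (4^-1).

Let measurable_bad sigma : measurable (bad sigma).
Proof.
apply: (V_estimator.2 [set f |
  (3%:E * min_dist H (hard sigma) + (4^-1)%:E < L1dist f (hard sigma))%E]).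
apply: (@L1_open_far _ _ b); first exact: H_cellwise.
exact: hard_density_cellwise.
Qed.

Let min_dist_hard sigma : (min_dist H (hard sigma) <= 0)%E.
Proof.
apply: ereal_inf_lbound; exists (hard sigma); first exact: hard_density_multiview.
have hc : cellwise (b := b) (hard sigma) by exact: hard_density_cellwise.
by rewrite (L1dist_cellwise hc hc) /cell_dist big1 ?mulr0// => m _; rewrite subrr normr0.
Qed.

(** Off the bad event the L1 error is at most 1/4, because [min_dist] is at most 0 here, and each
    wrong guess costs 1/(kh). On the bad event all kh guesses may be wrong. *)
Let sum_wrong_le sigma X : \sum_c \1_(wrong sigma c) X <=
  (k * h)%:R / 4 + (k * h)%:R * \1_(bad sigma) X :> R.
Proof.
have [SX|SX] := pselect (samples d.+2 n X); last first.
  rewrite big1 => [|c _]; first by rewrite addr_ge0 ?mulr_ge0.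
  by rewrite indicE memNset// => -[].
have wrongE c : \1_(wrong sigma c) X = (guess (V X) c != sigma c)%:R :> R.
  rewrite indicE; congr (_%:R); congr nat_of_bool.
  by apply/idP/idP => [/set_mem[]//|g]; apply/mem_set.
have [BX|BX] := pselect (bad sigma X).
  rewrite [\1_(bad _) _]indicE mem_set// mulr1.
  apply: (@le_trans _ _ (k * h)%:R); last by rewrite lerDr divr_ge0.
  rewrite (_ : (k * h)%:R = \sum_(c : pair) 1); last first.
    by rewrite sumr_const card_prod !card_ord.
  by apply: ler_sum => c _; rewrite indicE lern1 leq_b1.
rewrite [\1_(bad _) _]indicE memNset// mulr0 addr0.
have : (L1dist (V X) (hard sigma) <= (4^-1)%:E)%E.
  rewrite leNgt; apply/negP => far; apply: BX; split=> //=.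
  apply: le_lt_trans far; rewrite geeDr// mule_ge0_le0//.
rewrite (L1dist_cellwise (b := b)); last 2 first.
- by apply: H_cellwise; exact: V_estimator.1.
- exact: hard_density_cellwise.
rewrite lee_fin => close.
have := le_trans (cell_dist_hard_density k_gt0 h_gt0 k_le h_le (V X) sigma) close.
rewrite ler_pdivrMl ?ltr0n ?muln_gt0 ?k_gt0//.
by rewrite (eq_bigr _ (fun c _ => wrongE c)).
Qed.

Let missed c : set (n.-tuple point) :=
  [set X | forall i, cells (@off_pair d b k h c) (tnth X i)].

Let measurable_missed c : measurable (missed c).
Proof.
rewrite (_ : missed c = \bigcap_(i in [set: 'I_n])
    ((@tnth n point)^~ i @^-1` cells (@off_pair d b k h c))); last first.
  by apply/seteqP; split=> X hX i; [move=> _|]; exact: hX.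
apply: fin_bigcap_measurable => // i _.
rewrite -[X in measurable X]setTI.
by apply: measurable_tnth => //; exact: measurable_cells.
Qed.

Let mu_missed sigma c : mu sigma (missed c) = ((1 - (k * h)%:R^-1) ^+ n)%:E.
Proof.
apply: (etrans (tuple_measure_box (law sigma)
    (A := fun=> cells (@off_pair d b k h c)) _)).
  by move=> i; exact: measurable_cells.
rewrite (eq_bigr (fun=> (1 - (k * h)%:R^-1)%:E)) => [|i _]; last first.
  have := @law_off_pair R d b k h k_gt0 h_gt0 k_le h_le sigma c.
  by rewrite lawE.
by rewrite prodEFin prodr_const card_ord.
Qed.

Let mu_flip sigma c A : measurable A -> A `<=` missed c ->
  mu (flip c sigma) A = mu sigma A.
Proof.
move=> mA Ac; have eq_law B : measurable B -> B `<=` cells (@off_pair d b k h c) ->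
    law (flip c sigma) B = law sigma B.
  move=> _ Bc; have : density_law (hard (flip c sigma)) B = density_law (hard sigma) B.
    apply: eq_integral => x /set_mem[Bx _].
    by rewrite hard_density_flip//; exact: Bc.
  by rewrite !lawE.
exact: (@tuple_measure_eq_on _ _ R (law (flip c sigma)) (law sigma) _ n A eq_law mA Ac).
Qed.

(** A sample fixes the guess at [c], which is wrong for exactly one of [sigma] and [flip c sigma].
    The two error events thus split [missed c], on whose measurable subsets both laws agree. *)
Let wrong_flip sigma c :
  (mu sigma (missed c) <=
   mu sigma (wrong sigma c) + mu (flip c sigma) (wrong (flip c sigma) c))%E.
Proof.
have mW s : measurable (wrong s c `&` missed c) by exact: measurableI.
apply: (@le_trans _ _ (mu sigma (wrong sigma c `&` missed c) +
    mu (flip c sigma) (wrong (flip c sigma) c `&` missed c))%E); last first.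
  by apply: leeD; apply: le_measure; rewrite ?inE//; apply: subIsetl.
rewrite [X in (_ + X)%E](@mu_flip sigma c (wrong (flip c sigma) c `&` missed c));
  [|exact: mW|exact: subIsetr].
rewrite -measureU//; last first.
  rewrite -subset0 => X /= [[[_ /= e1] _] [[_ /= e2] _]].
  by move: e1 e2; rewrite ffunE eqxx addbT; case: (guess _ _); case: (sigma c).
apply: le_measure; rewrite ?inE//; first exact: measurableU.
move=> X MX; have SX : samples d.+2 n X by move=> i; have [] := MX i.
have [g|/negPn g] := boolP (guess (V X) c != sigma c); first by left.
by right; split=> //; split=> //=; rewrite ffunE eqxx addbT (eqP g); case: (sigma c).
Qed.

(** Here [t] bounds the worst-case failure probability at radius 1/4. The expected number of wrong
    guesses, averaged over [sigma], is at least kh(1 - n/(kh))/2 by [e_flip] and at most kh(1/4 + t)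
    by [e_sum]. *)
Lemma minimax_lower_bound (t : R) :
  (forall p, density d.+2 p ->
    (tuple_measure (density_law p) n (bad_samples H V p (4^-1)) <= t%:E)%E) ->
  1 - n%:R / (k * h)%:R <= 2 * (4^-1 + t).
Proof.
move=> bad_le; set M : R := (k * h)%:R.
have M_gt0 : 0 < M by rewrite ltr0n muln_gt0 k_gt0.
pose e sigma c := fine (mu sigma (wrong sigma c)).
have eE sigma c : mu sigma (wrong sigma c) = (e sigma c)%:E.
  rewrite fineK// ge0_fin_numE//; apply: (@le_lt_trans _ _ 1%E); last exact: ltry.
  by rewrite -(mu_setT sigma); apply: le_measure; rewrite ?inE.
have e_flip sigma c : 1 - n%:R / M <= e sigma c + e (flip c sigma) c.
  apply: (@le_trans _ _ ((1 - M^-1) ^+ n)).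
    apply: bernoulli_ineq; rewrite invr_ge0 ltW//= invf_le1//.
    by rewrite ler1n muln_gt0 k_gt0.
  by rewrite -lee_fin -(mu_missed sigma c) EFinD -!eE.
have e_sum sigma : \sum_c e sigma c <= M * (4^-1 + t).
  have M0 : 0 <= M by exact: ltW.
  have M40 : 0 <= M / 4 by rewrite divr_ge0.
  have := sum_measure_le_indic (mu_setT sigma) (measurable_wrong sigma)
    (measurable_bad sigma) M40 M0 (sum_wrong_le sigma).
  rewrite (eq_bigr _ (fun c _ => eE sigma c)) sumEFin -lee_fin => /le_trans; apply.
  rewrite mulrDr EFinD leeD2l// EFinM lee_wpmul2l ?lee_fin//.
  have := bad_le (hard sigma); rewrite lawE; apply.
  exact: density_hard_density.
(* For fixed [c], the involution [flip c] permutes the sign vectors, so both halves of the sum are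
   equal. *)
have sum_e_flip : \sum_sigma \sum_c (e sigma c + e (flip c sigma) c) =
    2 * \sum_sigma \sum_c e sigma c.
  under eq_bigr do rewrite big_split/=.
  rewrite big_split/= mulr_natl mulr2n; congr (_ + _).
  rewrite exchange_big [RHS]exchange_big; apply: eq_bigr => c _.
  by rewrite [RHS](reindex_inj (inv_inj (@flipK _ _ c))).
have : \sum_(sigma : signs) \sum_(c : pair) (1 - n%:R / M) <=
       \sum_(sigma : signs) M * (2 * (4^-1 + t)).
  apply: (@le_trans _ _ (2 * \sum_sigma \sum_c e sigma c)).
    by rewrite -sum_e_flip; apply: ler_sum => sigma _; apply: ler_sum => c _.
  by rewrite mulr_sumr; apply: ler_sum => sigma _; rewrite mulrCA ler_pM2l.
rewrite !sumr_const card_prod !card_ord -(mulr_natl (1 - _)) lerMn2r ler_pM2l//.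
(* The common factor, the number of sign vectors, is nonzero: the constant vector [true] is one of
   them. *)
by move=> /orP[/eqP/card0_eq/(_ [ffun=> true])|].
Qed.

End minimax_lower_bound.

(** * Contradiction at one large sample size *)

Theorem theorem2p3 (R : realType) (d : nat) (b k : nat -> nat)
    (d_ge2 : (2 <= d)%N)
    (b_gt0 : forall n, (0 < b n)%N) (k_gt0 : forall n, (0 < k n)%N)
    (b_oo : b @ \oo --> \oo) (k_oo : k @ \oo --> \oo)
    (k_le_b : forall n, (k n <= b n)%N)
    (n_bk : (n%:R / (b n * k n)%N%:R : R) @[n --> \oo] --> (0 : R)) :
  ~ exists V : forall n : nat,
        n.-tuple (d.-tuple (measurableTypeR R)) ->
        d.-tuple (measurableTypeR R) -> R,
      (forall n, estimator n (multiview_histogram d (b n) (k n)) (V n)) /\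
      forall eps : R, 0 < eps ->
        ereal_sup [set tuple_measure (density_law p) n
            (bad_samples (multiview_histogram d (b n) (k n)) (V n) p eps)
          | p in density d] @[n --> \oo] --> 0%E.
Proof.
move=> [V [V_est V_cvg]].
have quarter_gt0 : 0 < 4^-1 :> R by rewrite invr_gt0.
have /fine_cvgP[sup_fin sup_cvg] := V_cvg _ quarter_gt0.
have pos (m : nat) : 0 < m.+1%:R^-1 :> R by rewrite invr_gt0.
have b_ge2 : \forall n \near \oo, (2 <= b n)%N by exact: b_oo (nbhs_infty_ge 2).
(* With h = floor(b/2) >= b/3, the ratio n/(kh) is at most 3n/(bk) < 1/4. For t = 1/16 the lower
   bound would then give 3/4 < 2(1/4 + 1/16) = 5/8. *)
have [n [[[n_fin /= n_sup] /= n_ratio] n_b]] :=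
  filter_ex (filterI (filterI (filterI sup_fin
    (cvgr_lt _ sup_cvg _ (pos 15 : 0 < 16^-1)))
    (cvgr_lt _ n_bk _ (pos 11 : 0 < 12^-1))) b_ge2).
move: d d_ge2 V V_est n_fin n_sup {V_cvg sup_fin sup_cvg} =>
  [|[|d']]// _ V V_est n_fin n_sup.
have kn := k_gt0 n; have kb := k_le_b n; have Vn := V_est n.
case bE : (b n) => [|b'] in n_fin n_sup n_ratio n_b kb Vn; first by [].
have h_gt0 : (0 < b'.+1./2)%N by rewrite half_gt0.
have h_le : (b'.+1./2.*2 <= b'.+1)%N by rewrite -[leqRHS]odd_double_half leq_addl.
(* This needs b at least 2; equality holds at b = 3. *)
have b_le : (b'.+1 <= 3 * b'.+1./2)%N.
  by rewrite -[leqLHS]odd_double_half; case: odd; lia.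
move: n_fin n_sup; set S := ereal_sup _ => n_fin n_sup.
have sup_le p : density d'.+2 p ->
    (tuple_measure (density_law p) n
      (bad_samples (multiview_histogram d'.+2 b'.+1 (k n)) (V n) p 4^-1) <= (16^-1)%:E)%E.
  move=> dp; apply: (@le_trans _ _ S); first by apply: ereal_sup_ubound; exists p.
  by rewrite -(fineK n_fin) lee_fin; exact: ltW n_sup.
have := minimax_lower_bound kn h_gt0 kb h_le Vn sup_le.
have bk_gt0 : 0 < (b'.+1 * k n)%:R :> R by rewrite ltr0n muln_gt0 kn.
have kh_gt0 : 0 < (k n * b'.+1./2)%:R :> R by rewrite ltr0n muln_gt0 kn.
have : n%:R / (k n * b'.+1./2)%:R <= 3 * (n%:R / (b'.+1 * k n)%:R) :> R.
  rewrite mulrCA ler_wpM2l// ler_pdivlMr// mulrC ler_pdivrMr// -natrM ler_nat.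
  by rewrite mulnC mulnCA leq_mul2l b_le orbT.
move: n_ratio (n%:R / (k n * _)%:R); move: (n%:R / _) => q q_lt r r_le; lra.
Qed.
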